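(* Let $\mathcal{E}\subset\mathbb{R}^2$ be an ellipse that is not a circle. Then the set $\mathcal{C}\subset\mathbb{R}^2$ of the circumcenters of all triangular billiard orbits on $\mathcal{E}$ is also an ellipse.
   Context: A triangular (billiard) orbit on an ellipse $\mathcal{E}\subset\mathbb{R}^2$ is a 3-periodic orbit of the billiard inside $\mathcal{E}$, that is, a triangle $A_1A_2A_3$ with three distinct vertices on $\mathcal{E}$ such that for each $i$ (indices modulo 3) the lines $A_iA_{i+1}$ and $A_iA_{i-1}$ are symmetric to each other with respect to the tangent line to $\mathcal{E}$ at $A_i$ (usual reflection law). The circumcenter of a triangle is the center of its circumscribed circle. *)

(* Defs.v *)
From Stdlib Require Import Reals.
Open Scope R_scope.

Definition point : Type := (R * R)%type.

(* Subsets of the plane. *)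
Definition pset : Type := point -> Prop.

Definition padd (P Q : point) : point := (fst P + fst Q, snd P + snd Q).
Definition psub (P Q : point) : point := (fst P - fst Q, snd P - snd Q).
Definition pscale (t : R) (P : point) : point := (t * fst P, t * snd P).
Definition dot (u v : point) : R := fst u * fst v + snd u * snd v.
Definition perp (u : point) : point := (- snd u, fst u).
Definition dist2 (P Q : point) : R := dist_euc (fst P) (snd P) (fst Q) (snd Q).

Definition circle (O : point) (r : R) : pset := fun P => dist2 O P = r.

Definition is_circle (E : pset) : Prop :=
  exists (O : point) (r : R), 0 < r /\ forall P, E P <-> circle O r P.

(* [(dot (P - c) u, dot (P - c) (perp u))] are the coordinates of [P] in the
   orthonormal frame [(c; u, perp u)], so this is the curve
   x^2/a^2 + y^2/b^2 = 1 of that frame; a = b is allowed (circles). *)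
Definition is_ellipse (E : pset) : Prop :=
  exists (c u : point) (a b : R),
    dot u u = 1 /\ 0 < a /\ 0 < b /\
    forall P, E P <->
      (dot (psub P c) u) ^ 2 / a ^ 2 + (dot (psub P c) (perp u)) ^ 2 / b ^ 2 = 1.

(* The line through [A] directed by [v] (a line only when [v] is nonzero). *)
Definition line (A v : point) : pset :=
  fun P => exists t : R, P = padd A (pscale t v).

Definition line_through (A B : point) : pset := line A (psub B A).

(* Nonzero velocity at [A] of a curve drawn on [E]. *)
Definition tangent_vector (E : pset) (A v : point) : Prop :=
  v <> (0, 0) /\
  exists gamma : R -> point,
    (forall t, E (gamma t)) /\ gamma 0 = A /\
    derivable_pt_lim (fun t => fst (gamma t)) 0 (fst v) /\
    derivable_pt_lim (fun t => snd (gamma t)) 0 (snd v).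

(* Orthogonal reflection across [line A v], for nonzero [v]:
   A + w is sent to A + 2 (w.v / v.v) v - w. *)
Definition reflect (A v P : point) : point :=
  padd A (psub (pscale (2 * (dot (psub P A) v / dot v v)) v) (psub P A)).

Definition symmetric_lines (A v : point) (L1 L2 : pset) : Prop :=
  forall Q, L2 Q <-> exists P, L1 P /\ Q = reflect A v P.

(* [line A v] below is the tangent line to [E] at [A]. *)
Definition reflection_law (E : pset) (A B C : point) : Prop :=
  exists v, tangent_vector E A v /\
    symmetric_lines A v (line_through A B) (line_through A C).

Definition triangular_orbit (E : pset) (A1 A2 A3 : point) : Prop :=
  E A1 /\ E A2 /\ E A3 /\
  A1 <> A2 /\ A2 <> A3 /\ A3 <> A1 /\
  reflection_law E A1 A2 A3 /\
  reflection_law E A2 A3 A1 /\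
  reflection_law E A3 A1 A2.

Definition is_circumcenter (O A1 A2 A3 : point) : Prop :=
  exists r : R, 0 < r /\ circle O r A1 /\ circle O r A2 /\ circle O r A3.

Definition circumcenters (E : pset) : pset :=
  fun O => exists A1 A2 A3 : point,
    triangular_orbit E A1 A2 A3 /\ is_circumcenter O A1 A2 A3.

(* Main.v *)
Require Import Defs.
From Stdlib Require Import Reals Lra Psatz.
From Coquelicot Require Import Coquelicot.
Open Scope R_scope.

(** In orthonormal coordinates along the axes, write the vertices as
    [A_i = (a x_i, b y_i)] with [z_i = x_i + i y_i] a complex number of modulus
    one.  A chord from [z] to [w] has squared length [gap z w * chord_ratio a b z w],
    and its component along the normal of the ellipse at either endpoint is
    proportional to [gap z w].  Equal angles at a vertex therefore say that
    [gap / chord_ratio] is the same for both sides meeting there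
    ([reflection_law_iff]; this is the Joachimsthal integral), so an orbit is a
    triangle whose three sides have a common value [J] of this quotient.

    With [W = J (a^2 - b^2)], the equation of a side is a polynomial relation
    between [z_i] and [z_j].  Expressed through the third vertex and the elementary
    symmetric functions [s1, s2, s3] of the vertices, it is a quartic satisfied by
    all three [z_k]; reducing it by the cubic with roots [z_k] leaves a quadratic
    with three distinct roots, which is zero.  The result is
    [s2 = - W], [s1 = - W s3], and a quadratic equation for [J] with exactly one
    positive root ([phases_of_conjugate], [multiplier_unique]).  Conversely
    [s2 = - W] for this root makes the triangle an orbit ([orbit_iff]).

    The circumcenter of any triangle inscribed in the ellipse is
    [((a^2 - b^2) / (4 a) * Re (s1 + s3), (a^2 - b^2) / (4 b) * Im (s3 - s1))].
    On an orbit [s1 = - W s3], so it is the image of the unit number [s3] under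
    diagonal scaling by [(a^2 - b^2) (1 - W) / (4 a)] and
    [(a^2 - b^2) (1 + W) / (4 b)].  These factors are nonzero because [a <> b] and
    [|W| < 1]; hence the circumcenters lie on an ellipse.

    They fill it because every unit number is [s3] of some orbit
    ([phases_exist]).  A vertex [z] of an orbit satisfies
    [s3 = z (z - W conj z)^2 / |z - W conj z|^2], a map of the circle that is odd
    in [z] and hence onto by the intermediate value theorem; the two other vertices
    are then the points where the circle meets an explicit line, the polar of [z]
    with respect to a conic. *)

(** * Coordinates along the axes of the ellipse *)

Definition frame (c u X : point) : point :=
  padd c (padd (pscale (fst X) u) (pscale (snd X) (perp u))).
Definition stretch (a b : R) (z : point) : point := (a * fst z, b * snd z).

Lemma frame_dot (c u X Y X' Y' : point) (hu : dot u u = 1) :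
  dot (psub (frame c u X) (frame c u Y)) (psub (frame c u X') (frame c u Y'))
  = dot (psub X Y) (psub X' Y').
Proof.
  unfold dot, psub, frame, padd, pscale, perp in *; simpl in *.
  transitivity ((fst u * fst u + snd u * snd u) *
    ((fst X - fst Y) * (fst X' - fst Y') + (snd X - snd Y) * (snd X' - snd Y'))).
  - ring.
  - rewrite hu; ring.
Qed.

Lemma frame_cross (c u X Y X' Y' : point) (hu : dot u u = 1) :
  dot (perp (psub (frame c u X) (frame c u Y))) (psub (frame c u X') (frame c u Y'))
  = dot (perp (psub X Y)) (psub X' Y').
Proof.
  unfold dot, psub, frame, padd, pscale, perp in *; simpl in *.
  transitivity ((fst u * fst u + snd u * snd u) *
    (- (snd X - snd Y) * (fst X' - fst Y') + (fst X - fst Y) * (snd X' - snd Y'))).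
  - ring.
  - rewrite hu; ring.
Qed.

Lemma frame_surj (c u P : point) (hu : dot u u = 1) :
  P = frame c u (dot (psub P c) u, dot (psub P c) (perp u)).
Proof.
  unfold dot, psub, frame, padd, pscale, perp in *; destruct P as [p q], c as [c d], u as [u v]; simpl in *.
  f_equal.
  - transitivity (c + (p - c) * (u * u + v * v)); [rewrite hu|]; ring.
  - transitivity (d + (q - d) * (u * u + v * v)); [rewrite hu|]; ring.
Qed.

Lemma frame_coord (c u X : point) (hu : dot u u = 1) :
  dot (psub (frame c u X) c) u = fst X /\ dot (psub (frame c u X) c) (perp u) = snd X.
Proof.
  unfold dot, psub, frame, padd, pscale, perp in *; destruct X as [p q], c as [c d], u as [u v]; simpl in *.
  split.
  - transitivity (p * (u * u + v * v)); [|rewrite hu]; ring.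
  - transitivity (q * (u * u + v * v)); [|rewrite hu]; ring.
Qed.

Lemma ellipse_param (c u : point) (a b : R) (hu : dot u u = 1) (ha : a <> 0) (hb : b <> 0) P :
  (dot (psub P c) u) ^ 2 / a ^ 2 + (dot (psub P c) (perp u)) ^ 2 / b ^ 2 = 1 <->
  exists z, dot z z = 1 /\ P = frame c u (stretch a b z).
Proof.
  split.
  - intros H. exists (dot (psub P c) u / a, dot (psub P c) (perp u) / b). split.
    + rewrite <- H. unfold dot at 1; simpl fst; simpl snd. field; auto.
    + rewrite (frame_surj c u P hu) at 1. f_equal. unfold stretch; simpl. f_equal; field; auto.
  - intros [z [hz ->]].
    destruct (frame_coord c u (stretch a b z) hu) as [-> ->].
    rewrite <- hz. unfold dot, stretch; simpl. field; auto.
Qed.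

(** * Three points of the unit circle *)

Lemma unit_dot_lt (z w : point) : dot z z = 1 -> dot w w = 1 -> z <> w -> dot z w < 1.
Proof.
  destruct z as [x y], w as [x' y']; unfold dot; simpl; intros hz hw hne.
  destruct (Req_dec x x') as [->|h].
  - destruct (Req_dec y y') as [->|h]; [congruence|].
    assert (0 < (y - y') ^ 2) by (apply pow2_gt_0; lra). nra.
  - assert (0 < (x - x') ^ 2) by (apply pow2_gt_0; lra). nra.
Qed.

(** The square of twice the area of a triangle inscribed in the unit circle is
    a quarter of the product of its squared sides, and each squared side is
    [2 (1 - dot z w)]. *)
Lemma unit_noncollinear (z1 z2 z3 : point) : dot z1 z1 = 1 -> dot z2 z2 = 1 -> dot z3 z3 = 1 ->
  z1 <> z2 -> z2 <> z3 -> z3 <> z1 ->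
  dot (perp (psub z2 z1)) (psub z3 z1) <> 0.
Proof.
  intros h1 h2 h3 n12 n23 n31 H.
  pose proof (unit_dot_lt _ _ h1 h2 n12). pose proof (unit_dot_lt _ _ h2 h3 n23).
  pose proof (unit_dot_lt _ _ h3 h1 n31).
  assert (E : (dot (perp (psub z2 z1)) (psub z3 z1)) ^ 2 =
    2 * ((1 - dot z1 z2) * (1 - dot z2 z3) * (1 - dot z3 z1))).
  { destruct z1 as [x1 y1], z2 as [x2 y2], z3 as [x3 y3].
    unfold dot, psub, perp in *; simpl in *. clear - h1 h2 h3.
    assert (e1 : y1 * y1 = 1 - x1 * x1) by lra.
    assert (e2 : y2 * y2 = 1 - x2 * x2) by lra.
    assert (e3 : y3 * y3 = 1 - x3 * x3) by lra.
    ring_simplify. replace (y1^2) with (1 - x1*x1) by (rewrite <- e1; ring).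
    replace (y2^2) with (1 - x2*x2) by (rewrite <- e2; ring).
    replace (y3^2) with (1 - x3*x3) by (rewrite <- e3; ring).
    ring. }
  rewrite H in E.
  assert (0 < (1 - dot z1 z2) * (1 - dot z2 z3) * (1 - dot z3 z1))
    by (repeat apply Rmult_lt_0_compat; lra).
  simpl in E. lra.
Qed.

Lemma stretch_noncollinear (a b : R) (z1 z2 z3 : point) :
  0 < a -> 0 < b -> dot z1 z1 = 1 -> dot z2 z2 = 1 -> dot z3 z3 = 1 ->
  z1 <> z2 -> z2 <> z3 -> z3 <> z1 ->
  dot (perp (psub (stretch a b z2) (stretch a b z1))) (psub (stretch a b z3) (stretch a b z1)) <> 0.
Proof.
  intros ha hb u1 u2 u3 n12 n23 n31.
  replace (dot _ _) with (a * b * dot (perp (psub z2 z1)) (psub z3 z1))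
    by (unfold dot, perp, psub, stretch; simpl; ring).
  apply Rmult_integral_contrapositive_currified.
  - apply Rmult_integral_contrapositive_currified; lra.
  - apply unit_noncollinear; auto.
Qed.

(** * The reflection law on an ellipse *)

(** Two vectors make equal angles with the line directed by [n] exactly when the
    squared cosines agree.  The squared form also allows the two vectors to be
    parallel; the last hypothesis excludes this. *)
Lemma symmetric_lines_iff (A B C v n : point) :
  v <> (0, 0) -> dot v n = 0 -> n <> (0, 0) -> dot (psub B A) n <> 0 ->
  dot (perp (psub B A)) (psub C A) <> 0 ->
  (symmetric_lines A v (line_through A B) (line_through A C) <->
   (dot (psub C A) n) ^ 2 * dot (psub B A) (psub B A)
   = (dot (psub B A) n) ^ 2 * dot (psub C A) (psub C A)).
Proof.
  intros hv hvn hn hB hX.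
  (* The reflection only depends on the direction of the normal [n]. *)
  assert (R : forall P, reflect A v P =
     psub P (pscale (2 * (dot (psub P A) n / dot n n)) n)).
  { destruct v as [v1 v2], n as [n1 n2], A as [A1 A2]; intros [P1 P2].
    unfold reflect, dot, psub, padd, pscale in *; simpl in *.
    assert (Nv : v1 * v1 + v2 * v2 <> 0).
    { intros h. apply hv. f_equal; nra. }
    assert (Nn : n1 * n1 + n2 * n2 <> 0).
    { intros h. apply hn. f_equal; nra. }
    assert (Q : exists k, v1 = - k * n2 /\ v2 = k * n1).
    { exists ((v2 * n1 - v1 * n2) / (n1 * n1 + n2 * n2)). split.
      - apply (Rmult_eq_reg_r (n1 * n1 + n2 * n2)); auto. field_simplify; auto.
        replace (v1 * n1 ^ 2 + v1 * n2 ^ 2) with (n1 * (v1 * n1 + v2 * n2) - v2 * n1 * n2 + v1 * n2 ^ 2) by ring.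
        rewrite hvn; ring.
      - apply (Rmult_eq_reg_r (n1 * n1 + n2 * n2)); auto. field_simplify; auto.
        replace (v2 * n1 ^ 2 + v2 * n2 ^ 2) with (n2 * (v1 * n1 + v2 * n2) - v1 * n1 * n2 + v2 * n1 ^ 2) by ring.
        rewrite hvn; ring. }
    destruct Q as [k [-> ->]].
    assert (k <> 0) by (intros ->; apply Nv; ring).
    f_equal; field; split; auto; contradict Nn; nra. }
  unfold symmetric_lines. setoid_rewrite R. clear R hvn hv v.
  destruct n as [n1 n2], A as [A1 A2], B as [B1 B2], C as [C1 C2].
  unfold line_through, line, dot, psub, padd, pscale, perp in *; simpl in *.
  assert (Nn : n1 * n1 + n2 * n2 <> 0).
  { intros h. apply hn. f_equal; nra. }
  set (u1 := B1 - A1) in *. set (u2 := B2 - A2) in *.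
  set (w1 := C1 - A1) in *. set (w2 := C2 - A2) in *.
  split.
  - intros H. destruct (proj1 (H (C1, C2))) as [P [[t ->] e]].
    { exists 1. unfold w1, w2. f_equal; ring. }
    injection e as e1 e2.
    assert (f1 : w1 = t * (u1 - 2 * ((u1 * n1 + u2 * n2) / (n1 * n1 + n2 * n2)) * n1)).
    { unfold w1. rewrite e1. simpl. field; auto. }
    assert (f2 : w2 = t * (u2 - 2 * ((u1 * n1 + u2 * n2) / (n1 * n1 + n2 * n2)) * n2)).
    { unfold w2. rewrite e2. simpl. field; auto. }
    rewrite f1, f2. field; auto.
  - intros H.
    (* The hypothesis is a difference of two squares; one factor is the cross
       product of [u] and [w] times [n.n], so the other one vanishes. *)
    assert (K : (w1 * n1 + w2 * n2) * (- u2 * n1 + u1 * n2) = - ((u1 * n1 + u2 * n2) * (- w2 * n1 + w1 * n2))).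
    { assert (K : ((w1 * n1 + w2 * n2) * (- u2 * n1 + u1 * n2) - (u1 * n1 + u2 * n2) * (- w2 * n1 + w1 * n2))
        * ((w1 * n1 + w2 * n2) * (- u2 * n1 + u1 * n2) + (u1 * n1 + u2 * n2) * (- w2 * n1 + w1 * n2)) = 0).
      { transitivity ((n1 * n1 + n2 * n2) *
          ((w1 * n1 + w2 * n2) ^ 2 * (u1 * u1 + u2 * u2) - (u1 * n1 + u2 * n2) ^ 2 * (w1 * w1 + w2 * w2))); [ring|].
        simpl in H |- *. rewrite H. ring. }
      apply Rmult_integral in K. destruct K as [K|K]; [exfalso|lra].
      assert (K' : (- u2 * w1 + u1 * w2) * (n1 * n1 + n2 * n2) = 0) by lra.
      apply Rmult_integral in K'. tauto. }
    set (un := u1 * n1 + u2 * n2) in *. set (wn := w1 * n1 + w2 * n2) in *.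
    (* With [u = B - A] and [w = C - A], [w] is a multiple of the mirror image of
       [u]; the factor is read off from the components along [n]. *)
    assert (T : exists t, w1 = t * (u1 - 2 * (un / (n1 * n1 + n2 * n2)) * n1) /\
                          w2 = t * (u2 - 2 * (un / (n1 * n1 + n2 * n2)) * n2)).
    { exists (- (wn / un)). split.
      - apply (Rmult_eq_reg_r (un * (n1 * n1 + n2 * n2))); [|apply Rmult_integral_contrapositive; auto].
        transitivity (- wn * (u1 * (n1 * n1 + n2 * n2) - 2 * un * n1)); [|field; auto].
        transitivity (wn * un * n1 + un * (- w2 * n1 + w1 * n2) * n2); [unfold wn, un; ring|].
        replace (un * (- w2 * n1 + w1 * n2)) with (- (wn * (- u2 * n1 + u1 * n2))) by lra.
        unfold un; ring.
      - apply (Rmult_eq_reg_r (un * (n1 * n1 + n2 * n2))); [|apply Rmult_integral_contrapositive; auto].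
        transitivity (- wn * (u2 * (n1 * n1 + n2 * n2) - 2 * un * n2)); [|field; auto].
        transitivity (wn * un * n2 - un * (- w2 * n1 + w1 * n2) * n1); [unfold wn, un; ring|].
        replace (un * (- w2 * n1 + w1 * n2)) with (- (wn * (- u2 * n1 + u1 * n2))) by lra.
        unfold un; ring. }
    destruct T as [t [T1 T2]].
    assert (Nt : t <> 0).
    { intros ->. apply hX. rewrite T1, T2. ring. }
    intros [Q1 Q2]; split.
    + intros [s e]. injection e as e1 e2.
      exists (A1 + s * t * u1, A2 + s * t * u2). split.
      * exists (s * t); reflexivity.
      * simpl. rewrite e1, e2, T1, T2. unfold un. f_equal; field; auto.
    + intros [P [[s ->] e]]. simpl in e. injection e as e1 e2.
      exists (s / t). rewrite e1, e2, T1, T2. unfold un. f_equal; field; auto.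
Qed.

(** A multiple of the gradient of the equation of the ellipse. *)
Definition normal (u : point) (a b : R) (z : point) : point :=
  frame (0, 0) u (b * fst z, a * snd z).

Lemma velocity_orthogonal (E : pset) (c u : point) (a b : R) (z v : point)
  (hu : dot u u = 1) (ha : 0 < a) (hb : 0 < b)
  (hE : forall P, E P <-> exists z, dot z z = 1 /\ P = frame c u (stretch a b z)) :
  tangent_vector E (frame c u (stretch a b z)) v -> dot v (normal u a b z) = 0.
Proof.
  intros [_ [gamma [hg [h0 [d1 d2]]]]].
  apply is_derive_Reals in d1. apply is_derive_Reals in d2.
  set (g1 := fun t => fst (gamma t)) in *. set (g2 := fun t => snd (gamma t)) in *.
  set (X := fun t => (g1 t - fst c) * fst u + (g2 t - snd c) * snd u).
  set (Y := fun t => (g1 t - fst c) * - snd u + (g2 t - snd c) * fst u).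
  assert (X0 : X 0 = a * fst z).
  { destruct (frame_coord c u (stretch a b z) hu) as [e _].
    unfold X, g1, g2. rewrite h0. exact e. }
  assert (Y0 : Y 0 = b * snd z).
  { destruct (frame_coord c u (stretch a b z) hu) as [_ e].
    unfold Y, g1, g2. rewrite h0. exact e. }
  assert (C : forall t, (X t) ^ 2 / a ^ 2 + (Y t) ^ 2 / b ^ 2 = 1).
  { intros t. assert (na : a <> 0) by lra. assert (nb : b <> 0) by lra.
    exact (proj2 (ellipse_param c u a b hu na nb (gamma t)) (proj1 (hE _) (hg t))). }
  assert (D : is_derive (fun t => (X t) ^ 2 / a ^ 2 + (Y t) ^ 2 / b ^ 2) 0
    (2 * X 0 * (fst v * fst u + snd v * snd u) / a ^ 2 +
     2 * Y 0 * (fst v * - snd u + snd v * fst u) / b ^ 2)).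
  { unfold X, Y. auto_derive.
    - repeat split; try (eexists; eassumption).
    - replace (Derive (fun x : R => g1 x) 0) with (fst v)
        by (symmetry; exact (is_derive_unique _ _ _ d1)).
      replace (Derive (fun x : R => g2 x) 0) with (snd v)
        by (symmetry; exact (is_derive_unique _ _ _ d2)).
      field; lra. }
  assert (D' : is_derive (fun t => (X t) ^ 2 / a ^ 2 + (Y t) ^ 2 / b ^ 2) 0 0).
  { apply (is_derive_ext (fun _ => 1)); [intros t; now rewrite C|].
    apply @is_derive_const. }
  pose proof (is_derive_unique _ _ _ D) as e. rewrite (is_derive_unique _ _ _ D'), X0, Y0 in e.
  apply (Rmult_eq_compat_r (a * b / 2)) in e.
  transitivity ((2 * (a * fst z) * (fst v * fst u + snd v * snd u) / a ^ 2 +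
     2 * (b * snd z) * (fst v * - snd u + snd v * fst u) / b ^ 2) * (a * b / 2)).
  - unfold dot, normal, frame, padd, pscale, perp; simpl. field; lra.
  - rewrite <- e. ring.
Qed.

(** Rotating the parameter [z] at unit speed traces the ellipse. *)
Lemma tangent_vector_exists (E : pset) (c u : point) (a b : R) (z : point)
  (hu : dot u u = 1) (ha : 0 < a) (hb : 0 < b) (hz : dot z z = 1)
  (hE : forall P, E P <-> exists z, dot z z = 1 /\ P = frame c u (stretch a b z)) :
  exists v, tangent_vector E (frame c u (stretch a b z)) v.
Proof.
  destruct u as [u1 u2], z as [x y], c as [c1 c2].
  exists (- a * y * u1 - b * x * u2, - a * y * u2 + b * x * u1).
  split.
  - intros e. injection e as e1 e2. unfold dot in *; simpl in *.
    assert (K : (a * y) ^ 2 + (b * x) ^ 2 = 0).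
    { transitivity ((u1 * u1 + u2 * u2) * ((a * y) ^ 2 + (b * x) ^ 2)); [rewrite hu; ring|].
      transitivity ((- a * y * u1 - b * x * u2) ^ 2 + (- a * y * u2 + b * x * u1) ^ 2); [ring|].
      rewrite e1, e2; ring. }
    assert (a * y = 0) by nra. assert (b * x = 0) by nra.
    apply Rmult_integral in H. apply Rmult_integral in H0.
    destruct H as [H|H], H0 as [H0|H0]; try lra. subst; lra.
  - exists (fun t => frame (c1, c2) (u1, u2)
      (stretch a b (x * cos t - y * sin t, x * sin t + y * cos t))).
    split; [|split].
    + intros t. apply hE. eexists; split; [|reflexivity].
      unfold dot in *; simpl in *. pose proof (sin2_cos2 t) as e. unfold Rsqr in e.
      transitivity ((x * x + y * y) * (sin t * sin t + cos t * cos t)); [ring|].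
      rewrite hz, e; ring.
    + rewrite sin_0, cos_0. f_equal. unfold stretch; simpl. f_equal; ring.
    + split; apply is_derive_Reals; unfold frame, stretch, padd, pscale, perp; simpl;
        auto_derive; auto; rewrite sin_0, cos_0; simpl;
        match goal with |- @eq _ ?x ?y => change (@eq R x y) end; ring.
Qed.

(** Half the squared length of the chord of the unit circle from [z] to [w]. *)
Definition gap (z w : point) : R := 1 - dot z w.
(** Squared length of the chord of the ellipse, divided by [gap]; the last factor
    is the real part of the complex product [z * w]. *)
Definition chord_ratio (a b : R) (z w : point) : R :=
  a ^ 2 + b ^ 2 - (a ^ 2 - b ^ 2) * (fst z * fst w - snd z * snd w).

Lemma chord_sqr (a b : R) (z w : point) : dot z z = 1 -> dot w w = 1 ->
  dot (psub (stretch a b w) (stretch a b z)) (psub (stretch a b w) (stretch a b z))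
  = gap z w * chord_ratio a b z w.
Proof.
  destruct z as [x y], w as [x' y']; unfold dot, psub, stretch, gap, chord_ratio, dot; simpl.
  intros h h'.
  assert (e : y * y = 1 - x * x) by lra. assert (e' : y' * y' = 1 - x' * x') by lra.
  transitivity (a * a * (x' * x' + x * x - 2 * x * x') + b * b * (y' * y' + y * y - 2 * y * y')); [ring|].
  transitivity (a * a * (1 - 2 * x * x' + (x * x) * (x' * x') - (y * y) * (y' * y')) +
                b * b * (1 - 2 * y * y' + (y * y) * (y' * y') - (x * x) * (x' * x'))); [|ring].
  rewrite e, e'. ring.
Qed.

Lemma chord_ratio_pos (a b : R) (z w : point) : 0 < a -> 0 < b -> dot z z = 1 -> dot w w = 1 ->
  0 < chord_ratio a b z w.
Proof.
  intros ha hb hz hw. unfold chord_ratio. set (C := fst z * fst w - snd z * snd w).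
  assert (e : C ^ 2 + (fst z * snd w + snd z * fst w) ^ 2 = 1).
  { transitivity (dot z z * dot w w); [unfold C, dot; ring|rewrite hz, hw; ring]. }
  pose proof (pow2_ge_0 (fst z * snd w + snd z * fst w)).
  assert (-1 <= C <= 1) by (clearbody C; split; nra).
  replace (_ - _) with (a ^ 2 * (1 - C) + b ^ 2 * (1 + C)) by ring.
  assert (0 < a ^ 2) by nra. assert (0 < b ^ 2) by nra.
  destruct (Rle_dec C 0); nra.
Qed.

(** The normal at [z] meets the chord to [w] with component [- a b gap z w], and
    [chord_sqr] gives the length of this chord, so one factor [gap] cancels from
    each side of the equality of squared cosines. *)
Lemma reflection_law_iff (E : pset) (c u : point) (a b : R) (z w w' : point)
  (hu : dot u u = 1) (ha : 0 < a) (hb : 0 < b)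
  (hE : forall P, E P <-> exists z, dot z z = 1 /\ P = frame c u (stretch a b z))
  (hz : dot z z = 1) (hw : dot w w = 1) (hw' : dot w' w' = 1)
  (n1 : z <> w) (n2 : w <> w') (n3 : w' <> z) :
  reflection_law E (frame c u (stretch a b z)) (frame c u (stretch a b w))
    (frame c u (stretch a b w')) <->
  gap z w' * chord_ratio a b z w = gap z w * chord_ratio a b z w'.
Proof.
  set (A := frame c u (stretch a b z)). set (B := frame c u (stretch a b w)).
  set (C := frame c u (stretch a b w')).
  assert (N : forall w, dot (psub (frame c u (stretch a b w)) A) (normal u a b z)
             = - (a * b) * (gap z w + (dot z z - 1))).
  { intros [x' y']. replace (normal u a b z) with
      (psub (frame c u (b * fst z, a * snd z)) (frame c u (0, 0)))
      by (unfold normal, psub, frame, padd, pscale; simpl; f_equal; ring).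
    unfold A. rewrite (frame_dot c u _ _ _ _ hu).
    destruct z as [x y]. unfold dot, psub, stretch, gap, dot; simpl. ring. }
  assert (Q : forall w, dot w w = 1 ->
     dot (psub (frame c u (stretch a b w)) A) (psub (frame c u (stretch a b w)) A)
     = gap z w * chord_ratio a b z w).
  { intros p hp. unfold A. rewrite (frame_dot c u _ _ _ _ hu). apply chord_sqr; auto. }
  assert (X : dot (perp (psub B A)) (psub C A) <> 0).
  { unfold A, B, C. rewrite (frame_cross c u _ _ _ _ hu).
    apply stretch_noncollinear; auto. }
  assert (g1 : 0 < gap z w) by (pose proof (unit_dot_lt z w hz hw n1); unfold gap; lra).
  assert (g2 : 0 < gap z w').
  { assert (z <> w') by auto. pose proof (unit_dot_lt z w' hz hw' H); unfold gap; lra. }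
  assert (hab : 0 < a * b) by nra.
  assert (I : forall v, tangent_vector E A v ->
     (symmetric_lines A v (line_through A B) (line_through A C) <->
      gap z w' * chord_ratio a b z w = gap z w * chord_ratio a b z w')).
  { intros v hv.
    assert (ho := velocity_orthogonal E c u a b z v hu ha hb hE hv).
    rewrite (symmetric_lines_iff A B C v (normal u a b z)); auto.
    - unfold B, C. rewrite !N, !Q, hz; auto.
      replace ((- (a * b) * (gap z w' + (1 - 1))) ^ 2 * (gap z w * chord_ratio a b z w))
        with (((a * b) ^ 2 * gap z w * gap z w') * (gap z w' * chord_ratio a b z w)) by ring.
      replace ((- (a * b) * (gap z w + (1 - 1))) ^ 2 * (gap z w' * chord_ratio a b z w'))
        with (((a * b) ^ 2 * gap z w * gap z w') * (gap z w * chord_ratio a b z w')) by ring.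
      split; [|now intros ->]. intros H. apply Rmult_eq_reg_l in H; auto.
      assert (0 < (a * b) ^ 2 * gap z w * gap z w'); [|lra].
      apply Rmult_lt_0_compat; [apply Rmult_lt_0_compat|]; auto. apply pow_lt; auto.
    - exact (proj1 hv).
    - intros e. specialize (N w). rewrite e, hz in N. unfold dot in N; simpl in N.
      assert (0 < a * b * gap z w) by nra. nra.
    - unfold B. rewrite N, hz. assert (0 < a * b * gap z w) by nra. nra. }
  split.
  - intros [v [hv hs]]. apply (I v hv). exact hs.
  - intros H. destruct (tangent_vector_exists E c u a b z hu ha hb hz hE) as [v hv].
    exists v. split; auto. apply (I v hv). exact H.
Qed.

(** * Orbits in terms of symmetric functions of the vertices *)

Open Scope C_scope.

Lemma unit_conj (z : C) : dot z z = 1%R -> z * Cconj z = 1.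
Proof.
  destruct z as [x y]; unfold dot, Cconj, Cmult, RtoC; simpl; intros h. f_equal; [lra|ring].
Qed.

Lemma unit_neq_0 (z : C) : dot z z = 1%R -> z <> 0.
Proof.
  intros h ->. unfold dot in h; simpl in h. lra.
Qed.

Lemma Cmult_integral (z w : C) : z * w = 0 -> z = 0 \/ w = 0.
Proof.
  intros h. destruct (Ceq_dec z 0) as [e|e]; auto. right.
  transitivity (/ z * (z * w)); [field; auto|rewrite h; ring].
Qed.

Lemma Csub_neq_0 (z w : C) : z <> w -> z - w <> 0.
Proof.
  intros h e. apply h. transitivity (z - w + w); [ring|rewrite e; ring].
Qed.

Lemma quadratic_three_roots (p q r z1 z2 z3 : C) :
  z1 <> z2 -> z2 <> z3 -> z3 <> z1 ->
  p * z1 * z1 + q * z1 + r = 0 -> p * z2 * z2 + q * z2 + r = 0 ->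
  p * z3 * z3 + q * z3 + r = 0 -> p = 0 /\ q = 0 /\ r = 0.
Proof.
  intros n12 n23 n31 h1 h2 h3.
  assert (D : forall z w, z <> w -> p * z * z + q * z + r = 0 -> p * w * w + q * w + r = 0 ->
     p * (z + w) + q = 0).
  { intros z w n e e'. destruct (Cmult_integral (z - w) (p * (z + w) + q)) as [f|f]; auto.
    - transitivity (p * z * z + q * z + r - (p * w * w + q * w + r)); [ring|].
      rewrite e, e'; ring.
    - now apply Csub_neq_0 in n. }
  pose proof (D _ _ n12 h1 h2) as d12. pose proof (D _ _ n23 h2 h3) as d23.
  assert (hp : p = 0).
  { destruct (Cmult_integral (z3 - z1) p) as [f|f]; auto.
    - transitivity (p * (z2 + z3) + q - (p * (z1 + z2) + q)); [ring|].
      rewrite d12, d23; ring.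
    - now apply Csub_neq_0 in n31. }
  subst p. assert (hq : q = 0) by (rewrite <- d12; ring).
  subst q. repeat split; auto. rewrite <- h1; ring.
Qed.

(** Multiplied by [conj (z * w) / 2], for [z] and [w] on the unit circle, this
    reads [(1 - W) x x' + (1 + W) y y' = mu]: the two points are conjugate with respect
    to the conic [(1 - W) x^2 + (1 + W) y^2 = mu]. *)
Definition conjugate_phases (W mu : R) (z w : C) : Prop :=
  z * z + w * w = 2 * mu * (z * w) + W * (z * z * (w * w) + 1).

(** The complex equation is [- 2 z w] times the real one, once
    [z * Cconj z = w * Cconj w = 1] is used. *)
Lemma gap_chord_ratio_iff (a b J : R) (z w : C) : dot z z = 1%R -> dot w w = 1%R ->
  (gap z w = J * chord_ratio a b z w)%R <->
  conjugate_phases (J * (a ^ 2 - b ^ 2)) (1 - J * (a ^ 2 + b ^ 2)) z w.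
Proof.
  intros hz hw. unfold conjugate_phases.
  set (W := (J * (a ^ 2 - b ^ 2))%R). set (mu := (1 - J * (a ^ 2 + b ^ 2))%R).
  set (k := (gap z w - J * chord_ratio a b z w)%R).
  assert (I : z * z + w * w - (2 * mu * (z * w) + W * (z * z * (w * w) + 1)) = - (2 * (z * w) * RtoC k)).
  { assert (e : 2 * RtoC k = 2 * RtoC mu - (z * Cconj w + Cconj z * w) + W * (z * w + Cconj z * Cconj w)).
    { unfold k, W, mu, gap, chord_ratio, dot. destruct z as [x y], w as [x' y'].
      unfold Cplus, Cminus, Copp, Cmult, Cconj, RtoC; simpl. f_equal; ring. }
    transitivity (- (z * w * (2 * RtoC k))); [rewrite e|ring].
    pose proof (unit_conj z hz) as ez. pose proof (unit_conj w hw) as ew.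
    transitivity (z * z * (w * Cconj w) + w * w * (z * Cconj z) -
       (2 * mu * (z * w) + W * (z * z * (w * w) + (z * Cconj z) * (w * Cconj w))));
      [rewrite ez, ew|]; ring. }
  split; intros h.
  - assert (k0 : k = 0%R) by (unfold k; lra). rewrite k0 in I.
    transitivity (z * z + w * w - (2 * mu * (z * w) + W * (z * z * (w * w) + 1))
       + (2 * mu * (z * w) + W * (z * z * (w * w) + 1))); [ring|rewrite I; ring].
  - rewrite h in I. assert (e : z * (w * (2 * RtoC k)) = 0).
    { transitivity (- - (2 * (z * w) * RtoC k)); [ring|rewrite <- I; ring]. }
    apply Cmult_integral in e. destruct e as [e|e]; [now apply unit_neq_0 in e|].
    apply Cmult_integral in e. destruct e as [e|e]; [now apply unit_neq_0 in e|].
    rewrite <- RtoC_mult in e. apply RtoC_inj in e. unfold k in e; lra.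
Qed.

(** Since [z_i + z_j = s1 - z_k] and [z_i z_j z_k = s3], the relation between
    [z_i] and [z_j], multiplied by [z_k ^ 2], is a quartic in [z_k] with
    coefficients in [s1, s2, s3, W, mu].  Subtracting [z_k - s1] times the cubic
    with roots [z1, z2, z3] leaves the quadratic in the proof. *)
Lemma phases_of_conjugate (W mu : R) (z1 z2 z3 : C) :
  z1 <> z2 -> z2 <> z3 -> z3 <> z1 -> dot z1 z1 = 1%R -> dot z2 z2 = 1%R -> dot z3 z3 = 1%R ->
  conjugate_phases W mu z1 z2 -> conjugate_phases W mu z2 z3 -> conjugate_phases W mu z3 z1 ->
  z1 * z2 + z2 * z3 + z3 * z1 = - W /\ (W * W = 1 + 2 * mu)%R.
Proof.
  intros n12 n23 n31 u1 u2 u3 h12 h23 h31. unfold conjugate_phases in *.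
  set (s1 := z1 + z2 + z3). set (s2 := z1 * z2 + z2 * z3 + z3 * z1). set (s3 := z1 * z2 * z3).
  assert (Q : forall x y z, x + y + z = s1 -> x * y + y * z + z * x = s2 -> x * y * z = s3 ->
     x * x + y * y = 2 * mu * (x * y) + W * (x * x * (y * y) + 1) ->
     (- W - s2) * z * z + (s1 * s2 - (2 * mu + 1) * s3) * z + (- W * s3 * s3 - s1 * s3) = 0).
  { intros x y z <- <- <- h.
    transitivity (z * z * (x * x + y * y - (2 * mu * (x * y) + W * (x * x * (y * y) + 1)))).
    - ring.
    - rewrite h; ring. }
  destruct (quadratic_three_roots _ _ _ z1 z2 z3 n12 n23 n31
    (Q z2 z3 z1 ltac:(unfold s1; ring) ltac:(unfold s2; ring) ltac:(unfold s3; ring) h23)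
    (Q z3 z1 z2 ltac:(unfold s1; ring) ltac:(unfold s2; ring) ltac:(unfold s3; ring) h31)
    (Q z1 z2 z3 ltac:(unfold s1; ring) ltac:(unfold s2; ring) ltac:(unfold s3; ring) h12))
    as [e2 [e1 e0]].
  assert (N : s3 <> 0).
  { unfold s3. repeat apply Cmult_neq_0; now apply unit_neq_0. }
  assert (E2 : s2 = - W).
  { transitivity (- W - (- W - s2)); [ring|rewrite e2; ring]. }
  assert (E1 : s1 = - W * s3).
  { destruct (Cmult_integral s3 (- W * s3 - s1)) as [f|f]; [|tauto|].
    - rewrite <- e0; ring.
    - transitivity (- W * s3 - (- W * s3 - s1)); [ring|rewrite f; ring]. }
  split; auto.
  destruct (Cmult_integral s3 (W * W - (2 * mu + 1))) as [f|f]; [|tauto|].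
  - rewrite <- e1, E1, E2; ring.
  - assert (f' : RtoC (W * W - (2 * mu + 1)) = 0).
    { rewrite <- f. rewrite !RtoC_minus, !RtoC_plus, !RtoC_mult. ring. }
    apply RtoC_inj in f'. lra.
Qed.

(** On the unit circle conjugation is inversion, so [s1 = s3 * Cconj s2]. *)
Lemma sum_of_phases (W : R) (z1 z2 z3 : C) :
  dot z1 z1 = 1%R -> dot z2 z2 = 1%R -> dot z3 z3 = 1%R ->
  z1 * z2 + z2 * z3 + z3 * z1 = - W -> z1 + z2 + z3 = - W * (z1 * z2 * z3).
Proof.
  intros u1 u2 u3 h. apply unit_conj in u1, u2, u3.
  assert (e : Cconj (z1 * z2 + z2 * z3 + z3 * z1) = - W).
  { rewrite h. unfold Cconj, Copp, RtoC; simpl. f_equal; ring. }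
  rewrite !Cplus_conj, !Cmult_conj in e. rewrite <- e.
  transitivity (z1 * (z2 * Cconj z2) * (z3 * Cconj z3) + z2 * (z1 * Cconj z1) * (z3 * Cconj z3)
     + z3 * (z1 * Cconj z1) * (z2 * Cconj z2)); [rewrite u1, u2, u3|]; ring.
Qed.

Lemma conjugate_of_phases (W mu : R) (z1 z2 z3 : C) :
  dot z1 z1 = 1%R -> dot z2 z2 = 1%R -> dot z3 z3 = 1%R ->
  z1 * z2 + z2 * z3 + z3 * z1 = - W -> (W * W = 1 + 2 * mu)%R -> conjugate_phases W mu z1 z2.
Proof.
  intros u1 u2 u3 h2 hW. pose proof (sum_of_phases W z1 z2 z3 u1 u2 u3 h2) as h1.
  unfold conjugate_phases.
  assert (e : RtoC W * W = 1 + 2 * mu).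
  { rewrite <- !RtoC_mult, <- RtoC_plus. now rewrite hW. }
  assert (K : z3 * z3 * (z1 * z1 + z2 * z2 - (2 * mu * (z1 * z2) + W * (z1 * z1 * (z2 * z2) + 1))) = 0).
  { transitivity ((- W - (z1 * z2 + z2 * z3 + z3 * z1)) * z3 * z3
      + ((z1 + z2 + z3) * (z1 * z2 + z2 * z3 + z3 * z1) - (2 * mu + 1) * (z1 * z2 * z3)) * z3
      + (- W * (z1 * z2 * z3) * (z1 * z2 * z3) - (z1 + z2 + z3) * (z1 * z2 * z3))); [ring|].
    rewrite h2, h1. transitivity ((W * W - (1 + 2 * mu)) * (z1 * z2 * z3) * z3); [ring|].
    rewrite e; ring. }
  apply unit_neq_0 in u3.
  apply Cmult_integral in K; destruct K as [K|K].
  - apply Cmult_integral in K; tauto.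
  - transitivity (z1 * z1 + z2 * z2 - (2 * mu * (z1 * z2) + W * (z1 * z1 * (z2 * z2) + 1))
      + (2 * mu * (z1 * z2) + W * (z1 * z1 * (z2 * z2) + 1))); [ring|rewrite K; ring].
Qed.

Lemma unit_Cmod (z : C) : dot z z = 1%R -> Cmod z = 1%R.
Proof.
  intros h. unfold Cmod. rewrite <- sqrt_1 at 1. f_equal. rewrite <- h. unfold dot; ring.
Qed.

(** * Existence of orbits *)

(** If two of the points agree then [2 z1 z3 = - W - z1 ^ 2], where the left side
    has modulus [2] and the right side at most [|W| + 1]. *)
Lemma phases_distinct (W : R) (z1 z2 z3 : C) :
  dot z1 z1 = 1%R -> dot z3 z3 = 1%R -> (Rabs W < 1)%R ->
  z1 * z2 + z2 * z3 + z3 * z1 = - W -> z1 <> z2.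
Proof.
  intros u1 u3 hW h <-.
  assert (e : 2 * (z1 * z3) = - W + - (z1 * z1)) by (rewrite <- h; ring).
  apply unit_Cmod in u1, u3.
  pose proof (Cmod_triangle (- W) (- (z1 * z1))) as T.
  rewrite <- e, !Cmod_opp, !Cmod_mult, !Cmod_R, u1, u3 in T.
  rewrite (Rabs_pos_eq 2) in T; lra.
Qed.

Close Scope C_scope.

(** With [z = x + i y], this says [z (z - w conj z)^2 = zeta |z - w conj z|^2].
    The two sides are parallel as soon as [F], the imaginary part of the left side
    divided by [zeta], vanishes.  The left side is odd in [z], which gives [F] a
    zero on a half turn; replacing [z] by [- z] if needed corrects the sign. *)
Lemma phase_root (w : R) (zeta : point) : dot zeta zeta = 1 ->
  exists x y, x * x + y * y = 1 /\
    x * (((1 - w) * x) ^ 2 - ((1 + w) * y) ^ 2) - 2 * y * ((1 - w) * x) * ((1 + w) * y)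
      = fst zeta * (((1 - w) * x) ^ 2 + ((1 + w) * y) ^ 2) /\
    y * (((1 - w) * x) ^ 2 - ((1 + w) * y) ^ 2) + 2 * x * ((1 - w) * x) * ((1 + w) * y)
      = snd zeta * (((1 - w) * x) ^ 2 + ((1 + w) * y) ^ 2).
Proof.
  destruct zeta as [xi eta]; unfold dot; simpl fst; simpl snd; intros hz.
  set (re := fun x y => x * (((1 - w) * x) ^ 2 - ((1 + w) * y) ^ 2) - 2 * y * ((1 - w) * x) * ((1 + w) * y)).
  set (im := fun x y => y * (((1 - w) * x) ^ 2 - ((1 + w) * y) ^ 2) + 2 * x * ((1 - w) * x) * ((1 + w) * y)).
  set (L := fun x y => ((1 - w) * x) ^ 2 + ((1 + w) * y) ^ 2).
  set (F := fun t => xi * im (cos t) (sin t) - eta * re (cos t) (sin t)).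
  assert (cF : continuity F) by (unfold F, im, re; reg).
  destruct (IVT_cor F 0 PI cF) as [t [_ ht]].
  - pose proof PI_RGT_0; lra.
  - unfold F, im, re. rewrite cos_0, sin_0, cos_PI, sin_PI.
    pose proof (pow2_ge_0 (eta * (1 - w) ^ 2)) as p.
    match goal with |- ?q <= 0 => replace q with (- (eta * (1 - w) ^ 2) ^ 2) by ring end.
    lra.
  - set (x := cos t) in *. set (y := sin t) in *.
    assert (hu : x * x + y * y = 1).
    { pose proof (sin2_cos2 t) as e. unfold Rsqr in e. unfold x, y. lra. }
    set (G := xi * re x y + eta * im x y).
    change (xi * im x y - eta * re x y = 0) in ht.
    assert (hre : re x y = xi * G).
    { transitivity (xi * G - eta * (xi * im x y - eta * re x y)); [|rewrite ht; ring].
      transitivity ((xi * xi + eta * eta) * re x y); [rewrite hz|unfold G]; ring. }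
    assert (him : im x y = eta * G).
    { transitivity (eta * G + xi * (xi * im x y - eta * re x y)); [|rewrite ht; ring].
      transitivity ((xi * xi + eta * eta) * im x y); [rewrite hz|unfold G]; ring. }
    assert (hG : (G - L x y) * (G + L x y) = 0).
    { transitivity ((xi * xi + eta * eta) * G ^ 2 - L x y ^ 2); [rewrite hz; ring|].
      transitivity (re x y ^ 2 + im x y ^ 2 - L x y ^ 2); [rewrite hre, him; ring|].
      transitivity ((x * x + y * y - 1) * L x y ^ 2); [unfold re, im, L; ring|].
      rewrite hu; ring. }
    apply Rmult_integral in hG. destruct hG as [hG|hG].
    + exists x, y. assert (e : G = L x y) by lra. rewrite e in hre, him.
      repeat split; auto.
    + exists (- x), (- y). assert (e : G = - L x y) by lra. rewrite e in hre, him.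
      repeat split.
      * lra.
      * transitivity (- re x y); [unfold re; ring|]. rewrite hre; unfold L; ring.
      * transitivity (- im x y); [unfold im; ring|]. rewrite him; unfold L; ring.
Qed.

(** For [z1] given by [phase_root], [z2] and [z3] are the intersections of the
    unit circle with the line [l x + m y = r], where [l + i m = z1 - w conj z1].
    The value of [r] is forced by [z1 (z2 + z3) + z2 z3 = - w]. *)
Lemma phases_exist (w : R) (zeta : point) : dot zeta zeta = 1 -> Rabs w < 1 ->
  exists z1 z2 z3 : C, dot z1 z1 = 1 /\ dot z2 z2 = 1 /\ dot z3 z3 = 1 /\
    (z1 * z2 + z2 * z3 + z3 * z1 = - w)%C /\ (z1 * z2 * z3)%C = zeta.
Proof.
  intros hz hw. destruct (phase_root w zeta hz) as [x [y [hu [hre him]]]].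
  set (l := (1 - w) * x) in *. set (m := (1 + w) * y) in *.
  set (r := - (1 - w ^ 2) / 2). set (L := l ^ 2 + m ^ 2) in *.
  (* The line is a secant: [L] is a convex combination of [(1 - w)^2] and
     [(1 + w)^2], both less than [4], and [r ^ 2] is a quarter of
     their product. *)
  assert (hr : r ^ 2 < L).
  { apply Rabs_def2 in hw. unfold r, L, l, m.
    assert (e : y * y = 1 - x * x) by lra.
    replace (((1 - w) * x) ^ 2 + ((1 + w) * y) ^ 2) with
      ((1 - w) ^ 2 * (x * x) + (1 + w) ^ 2 * (y * y)) by ring. rewrite e.
    assert (0 <= x * x <= 1) by nra.
    set (X := x * x) in *. clearbody X.
    assert ((- (1 - w ^ 2) / 2) ^ 2 < (1 - w) ^ 2).
    { replace ((- (1 - w ^ 2) / 2) ^ 2) with ((1 - w) ^ 2 * ((1 + w) ^ 2 / 4)) by field.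
      assert (0 < (1 - w) ^ 2) by (apply pow_lt; lra).
      rewrite <- (Rmult_1_r ((1 - w) ^ 2)) at 2. apply Rmult_lt_compat_l; [auto|nra]. }
    assert ((- (1 - w ^ 2) / 2) ^ 2 < (1 + w) ^ 2).
    { replace ((- (1 - w ^ 2) / 2) ^ 2) with ((1 + w) ^ 2 * ((1 - w) ^ 2 / 4)) by field.
      assert (0 < (1 + w) ^ 2) by (apply pow_lt; lra).
      rewrite <- (Rmult_1_r ((1 + w) ^ 2)) at 2. apply Rmult_lt_compat_l; [auto|nra]. }
    set (A := (1 - w) ^ 2) in *. set (B := (1 + w) ^ 2) in *.
    set (K := (- (1 - w ^ 2) / 2) ^ 2) in *. clearbody A B K.
    destruct (Req_dec X 0) as [->|]; [lra|nra]. }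
  assert (hL : 0 < L) by (pose proof (pow2_ge_0 r); lra).
  set (s := sqrt (L - r ^ 2)).
  assert (hs : s ^ 2 = L - r ^ 2) by (unfold s; apply pow2_sqrt; lra).
  assert (U : forall s, s ^ 2 = L - r ^ 2 ->
     (r * l - m * s) / L * ((r * l - m * s) / L) + (r * m + l * s) / L * ((r * m + l * s) / L) = 1).
  { intros s' e. transitivity ((r ^ 2 + s' ^ 2) * (l ^ 2 + m ^ 2) / (L * L)); [field; lra|].
    rewrite e. fold L. field; lra. }
  set (z2 := ((r * l - m * s) / L, (r * m + l * s) / L) : C).
  set (z3 := ((r * l - m * - s) / L, (r * m + l * - s) / L) : C).
  set (sum := (2 * r * l / L, 2 * r * m / L) : C).
  set (prod := ((l ^ 2 - m ^ 2) / L, 2 * l * m / L) : C).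
  exists (x, y), z2, z3.
  split; [exact hu|]. split; [apply U; auto|]. split; [apply U; rewrite <- hs; ring|].
  assert (P : (z2 * z3)%C = prod).
  { unfold z2, z3, prod, Cmult; simpl fst; simpl snd. f_equal.
    - transitivity ((l ^ 2 - m ^ 2) * (r ^ 2 + s ^ 2) / (L * L)); [field; lra|].
      rewrite hs. field; lra.
    - transitivity (2 * l * m * (r ^ 2 + s ^ 2) / (L * L)); [field; lra|].
      rewrite hs. field; lra. }
  split.
  - transitivity (prod + (x, y) * sum)%C.
    + rewrite <- P. unfold z2, z3, sum, Cmult, Cplus; simpl fst; simpl snd. f_equal; field; lra.
    + unfold prod, sum, Cmult, Cplus, Copp, RtoC; simpl fst; simpl snd. f_equal.
      * transitivity ((- w) * L / L); [|field; lra].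
        transitivity ((l ^ 2 - m ^ 2 + 2 * r * (x * l - y * m)) / L); [field; lra|].
        f_equal. unfold r, L, l, m. field.
      * transitivity ((2 * l * m + 2 * r * (x * m + y * l)) / L); [field; lra|].
        replace (2 * l * m + 2 * r * (x * m + y * l)) with 0; [field; lra|].
        unfold r, l, m. field.
  - rewrite <- Cmult_assoc, P. unfold prod, Cmult; simpl fst; simpl snd.
    rewrite (surjective_pairing zeta). f_equal.
    + transitivity ((x * (l ^ 2 - m ^ 2) - 2 * y * l * m) / L); [field; lra|].
      rewrite hre. field; lra.
    + transitivity ((y * (l ^ 2 - m ^ 2) + 2 * x * l * m) / L); [field; lra|].
      rewrite him. field; lra.
Qed.

(** * The common value of gap over chord ratio *)

(** The equation is [W ^ 2 = 1 + 2 mu] with [W = J (a^2 - b^2)] and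
    [mu = 1 - J (a^2 + b^2)].  As a quadratic in [J] it has negative constant term
    and nonnegative leading and positive linear coefficients, hence one positive
    root.  Rationalizing the numerator of the quadratic formula gives a form of it
    that is valid also when [a = b]. *)
Lemma multiplier_exists (a b : R) : 0 < a -> 0 < b ->
  exists J, 0 < J /\ (J * (a ^ 2 - b ^ 2)) ^ 2 = 1 + 2 * (1 - J * (a ^ 2 + b ^ 2)).
Proof.
  intros ha hb. set (d := a ^ 2 - b ^ 2). set (S := a ^ 2 + b ^ 2).
  assert (hS : 0 < S) by (unfold S; nra).
  set (D := sqrt (S ^ 2 + 3 * d ^ 2)).
  assert (hD : D ^ 2 = S ^ 2 + 3 * d ^ 2) by (unfold D; apply pow2_sqrt; nra).
  assert (0 <= D) by apply sqrt_pos.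
  exists (3 / (S + D)). split; [apply Rdiv_lt_0_compat; lra|].
  apply (Rmult_eq_reg_r ((S + D) ^ 2)); [|apply pow_nonzero; lra].
  transitivity (9 * d ^ 2); [field; lra|].
  transitivity (3 * (S + D) ^ 2 - 6 * S * (S + D)); [|field; lra].
  replace (3 * (S + D) ^ 2 - 6 * S * (S + D)) with (3 * D ^ 2 - 3 * S ^ 2) by ring.
  rewrite hD. ring.
Qed.

Lemma multiplier_unique (a b J J' : R) : 0 < a -> 0 < b -> 0 < J -> 0 < J' ->
  (J * (a ^ 2 - b ^ 2)) ^ 2 = 1 + 2 * (1 - J * (a ^ 2 + b ^ 2)) ->
  (J' * (a ^ 2 - b ^ 2)) ^ 2 = 1 + 2 * (1 - J' * (a ^ 2 + b ^ 2)) -> J = J'.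
Proof.
  intros ha hb hJ hJ' h h'.
  assert (e : (J - J') * ((J + J') * (a ^ 2 - b ^ 2) ^ 2 + 2 * (a ^ 2 + b ^ 2)) = 0).
  { transitivity ((J * (a ^ 2 - b ^ 2)) ^ 2 - (1 + 2 * (1 - J * (a ^ 2 + b ^ 2)))
      - ((J' * (a ^ 2 - b ^ 2)) ^ 2 - (1 + 2 * (1 - J' * (a ^ 2 + b ^ 2))))); [ring|lra]. }
  apply Rmult_integral in e. destruct e as [e|e]; [lra|exfalso].
  assert (0 <= (J + J') * (a ^ 2 - b ^ 2) ^ 2) by (apply Rmult_le_pos; [lra|apply pow2_ge_0]).
  nra.
Qed.

(** If [|W| >= 1] then [mu >= 0], whereas [a^2 + b^2 > |a^2 - b^2|] forces
    [mu < 1 - |W| <= 0]. *)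
Lemma multiplier_bound (a b J : R) : 0 < a -> 0 < b -> 0 < J ->
  (J * (a ^ 2 - b ^ 2)) ^ 2 = 1 + 2 * (1 - J * (a ^ 2 + b ^ 2)) ->
  Rabs (J * (a ^ 2 - b ^ 2)) < 1.
Proof.
  intros ha hb hJ h.
  assert (0 < J * a ^ 2) by (apply Rmult_lt_0_compat; [|apply pow_lt]; auto).
  assert (0 < J * b ^ 2) by (apply Rmult_lt_0_compat; [|apply pow_lt]; auto).
  apply Rabs_def1; nra.
Qed.

(** * Circumcenters *)

(** For any triangle inscribed in the ellipse, the center is
    [((a^2 - b^2) / (4 a) * Re (s1 + s3), (a^2 - b^2) / (4 b) * Im (s3 - s1))];
    the hypothesis [s1 = - W s3] turns this into [O].  Equidistance follows from
    [Re ((z1 - z2) s1 + (conj z1 - conj z2) s3) = Re (z1 ^ 2 - z2 ^ 2)]. *)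
Lemma circumcenter_equidistant (a b W : R) (z1 z2 z3 : C) :
  a <> 0 -> b <> 0 -> dot z1 z1 = 1 -> dot z2 z2 = 1 ->
  (z1 + z2 + z3 = - W * (z1 * z2 * z3))%C ->
  let O := stretch ((a ^ 2 - b ^ 2) * (1 - W) / (4 * a)) ((a ^ 2 - b ^ 2) * (1 + W) / (4 * b))
    (z1 * z2 * z3)%C in
  dot (psub O (stretch a b z1)) (psub O (stretch a b z1))
  = dot (psub O (stretch a b z2)) (psub O (stretch a b z2)).
Proof.
  intros ha hb u1 u2 h. set (s3 := (z1 * z2 * z3)%C) in *.
  assert (hX : W * fst s3 = - fst (z1 + z2 + z3)%C).
  { rewrite h. unfold Cmult, Copp, RtoC; simpl; ring. }
  assert (hY : W * snd s3 = - snd (z1 + z2 + z3)%C).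
  { rewrite h. unfold Cmult, Copp, RtoC; simpl; ring. }
  intros O.
  assert (e1 : 4 * a * fst O = (a ^ 2 - b ^ 2) * (fst s3 + fst (z1 + z2 + z3)%C)).
  { transitivity ((a ^ 2 - b ^ 2) * (fst s3 - W * fst s3)); [|rewrite hX; ring].
    unfold O, stretch; simpl; field; auto. }
  assert (e2 : 4 * b * snd O = (a ^ 2 - b ^ 2) * (snd s3 - snd (z1 + z2 + z3)%C)).
  { transitivity ((a ^ 2 - b ^ 2) * (snd s3 + W * snd s3)); [|rewrite hY; ring].
    unfold O, stretch; simpl; field; auto. }
  clearbody O. clear h hX hY. subst s3.
  destruct z1 as [x1 y1], z2 as [x2 y2], z3 as [x3 y3], O as [X Y].
  unfold dot, psub, stretch, Cmult, Cplus in *; simpl in *.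
  assert (f1 : y1 * y1 = 1 - x1 * x1) by lra. assert (f2 : y2 * y2 = 1 - x2 * x2) by lra.
  cut (2 * (a * (x1 - x2) * (4 * a * X) / a + b * (y1 - y2) * (4 * b * Y) / b) =
       4 * (a ^ 2 * (x1 * x1 - x2 * x2) + b ^ 2 * (y1 * y1 - y2 * y2))).
  - intros K.
    replace (a * (x1 - x2) * (4 * a * X) / a) with (4 * (a * (x1 - x2) * X)) in K by (field; auto).
    replace (b * (y1 - y2) * (4 * b * Y) / b) with (4 * (b * (y1 - y2) * Y)) in K by (field; auto).
    lra.
  - rewrite e1, e2.
    replace (a * (x1 - x2) * ((a * (a * 1) - b * (b * 1)) *
       ((x1 * x2 - y1 * y2) * x3 - (x1 * y2 + y1 * x2) * y3 + (x1 + x2 + x3))) / a)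
     with ((a ^ 2 - b ^ 2) * ((x1 - x2) *
       ((x1 * x2 - y1 * y2) * x3 - (x1 * y2 + y1 * x2) * y3 + (x1 + x2 + x3))))
     by (field; auto).
    match goal with |- 2 * (_ + ?q) = _ =>
      replace q with ((a ^ 2 - b ^ 2) * ((y1 - y2) *
        ((x1 * x2 - y1 * y2) * y3 + (x1 * y2 + y1 * x2) * x3 - (y1 + y2 + y3))))
        by (field; auto)
    end.
    rewrite f1, f2.
    transitivity (2 * (a ^ 2 - b ^ 2) * ((x1 * x1 - y1 * y1) - (x2 * x2 - y2 * y2)
      + (x1 * x1 + y1 * y1 - 1) * (x2 * x3 - y2 * y3) - (x2 * x2 + y2 * y2 - 1) * (x1 * x3 - y1 * y3))); [ring|].
    rewrite f1, f2. ring.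
Qed.

Lemma phases_circumcenter (a b W : R) (z1 z2 z3 : C) :
  a <> 0 -> b <> 0 -> dot z1 z1 = 1 -> dot z2 z2 = 1 -> dot z3 z3 = 1 ->
  (z1 * z2 + z2 * z3 + z3 * z1 = - RtoC W)%C ->
  let O := stretch ((a ^ 2 - b ^ 2) * (1 - W) / (4 * a)) ((a ^ 2 - b ^ 2) * (1 + W) / (4 * b))
    (z1 * z2 * z3)%C in
  dot (psub O (stretch a b z1)) (psub O (stretch a b z1)) =
    dot (psub O (stretch a b z2)) (psub O (stretch a b z2)) /\
  dot (psub O (stretch a b z1)) (psub O (stretch a b z1)) =
    dot (psub O (stretch a b z3)) (psub O (stretch a b z3)).
Proof.
  intros na nb u1 u2 u3 s2 O.
  pose proof (sum_of_phases W z1 z2 z3 u1 u2 u3 s2) as s1. split.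
  - apply (circumcenter_equidistant a b W z1 z2 z3); auto.
  - unfold O. replace (z1 * z2 * z3)%C with (z1 * z3 * z2)%C by ring.
    apply (circumcenter_equidistant a b W z1 z3 z2); auto.
    replace (z1 * z3 * z2)%C with (z1 * z2 * z3)%C by ring. rewrite <- s1; ring.
Qed.

Lemma equidistant_unique (O O' A B C : point) :
  dot (perp (psub B A)) (psub C A) <> 0 ->
  dot (psub O A) (psub O A) = dot (psub O B) (psub O B) ->
  dot (psub O A) (psub O A) = dot (psub O C) (psub O C) ->
  dot (psub O' A) (psub O' A) = dot (psub O' B) (psub O' B) ->
  dot (psub O' A) (psub O' A) = dot (psub O' C) (psub O' C) -> O = O'.
Proof.
  destruct O as [p q], O' as [p' q'], A as [A1 A2], B as [B1 B2], C as [C1 C2].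
  unfold dot, perp, psub; simpl. intros hd h1 h2 h3 h4.
  assert (e1 : (p - p') * (B1 - A1) + (q - q') * (B2 - A2) = 0) by lra.
  assert (e2 : (p - p') * (C1 - A1) + (q - q') * (C2 - A2) = 0) by lra.
  f_equal; apply Rminus_diag_uniq; eapply Rmult_eq_reg_r; try exact hd.
  - transitivity ((C2 - A2) * ((p - p') * (B1 - A1) + (q - q') * (B2 - A2))
      - (B2 - A2) * ((p - p') * (C1 - A1) + (q - q') * (C2 - A2))); [ring|rewrite e1, e2; ring].
  - transitivity ((B1 - A1) * ((p - p') * (C1 - A1) + (q - q') * (C2 - A2))
      - (C1 - A1) * ((p - p') * (B1 - A1) + (q - q') * (B2 - A2))); [ring|rewrite e1, e2; ring].
Qed.

Lemma dist2_frame (c u X Y : point) (hu : dot u u = 1) :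
  dist2 (frame c u X) (frame c u Y) = sqrt (dot (psub X Y) (psub X Y)).
Proof.
  rewrite <- (frame_dot c u X Y X Y hu). reflexivity.
Qed.

Lemma unit_mult (z w : C) : dot z z = 1 -> dot w w = 1 -> dot (z * w)%C (z * w)%C = 1.
Proof.
  intros hz hw. transitivity (dot z z * dot w w); [|rewrite hz, hw; ring].
  unfold dot, Cmult; simpl; ring.
Qed.

Lemma stretch_equal_circle (E : pset) (c u : point) (a : R) (hu : dot u u = 1) (ha : 0 < a)
  (hE : forall P, E P <-> exists z, dot z z = 1 /\ P = frame c u (stretch a a z)) :
  is_circle E.
Proof.
  exists c, a. split; auto.
  intros P. rewrite hE. unfold circle.
  assert (dc : forall X, dist2 c (frame c u X) = sqrt (dot X X)).
  { intros X. transitivity (dist2 (frame c u (0, 0)) (frame c u X)).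
    - apply (f_equal (fun Q => dist2 Q (frame c u X))). destruct c; unfold frame, padd, pscale; simpl; f_equal; simpl; ring.
    - rewrite dist2_frame by auto. f_equal. unfold dot, psub; simpl; ring. }
  split.
  - intros [z [hz ->]]. rewrite dc. transitivity (sqrt (a ^ 2)); [f_equal|apply sqrt_pow2; lra].
    transitivity (a ^ 2 * dot z z); [unfold dot, stretch; simpl; ring|rewrite hz; ring].
  - intros h. rewrite (frame_surj c u P hu) in h |- *.
    set (X := (dot (psub P c) u, dot (psub P c) (perp u))) in *.
    rewrite dc in h. apply (f_equal (fun t => t ^ 2)) in h.
    rewrite pow2_sqrt in h by (unfold dot; nra).
    exists (fst X / a, snd X / a). split.
    + apply (Rmult_eq_reg_r (a ^ 2)); [|apply pow_nonzero; lra].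
      transitivity (dot X X); [unfold dot; simpl; field; lra|rewrite h; ring].
    + f_equal. rewrite (surjective_pairing X). unfold stretch; simpl. f_equal; field; lra.
Qed.

(** * Orbits and the locus of their circumcenters *)

Lemma orbit_iff (E : pset) (c u : point) (a b J : R) (z1 z2 z3 : C)
  (hu : dot u u = 1) (ha : 0 < a) (hb : 0 < b)
  (hE : forall P, E P <-> exists z, dot z z = 1 /\ P = frame c u (stretch a b z))
  (hJ : 0 < J) (hJ2 : (J * (a ^ 2 - b ^ 2)) ^ 2 = 1 + 2 * (1 - J * (a ^ 2 + b ^ 2)))
  (u1 : dot z1 z1 = 1) (u2 : dot z2 z2 = 1) (u3 : dot z3 z3 = 1)
  (n12 : z1 <> z2) (n23 : z2 <> z3) (n31 : z3 <> z1) :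
  triangular_orbit E (frame c u (stretch a b z1)) (frame c u (stretch a b z2))
    (frame c u (stretch a b z3)) <->
  (z1 * z2 + z2 * z3 + z3 * z1 = - RtoC (J * (a ^ 2 - b ^ 2)))%C.
Proof.
  assert (sg : forall z w, gap z w = gap w z) by (intros; unfold gap, dot; ring).
  assert (sw : forall z w, chord_ratio a b z w = chord_ratio a b w z) by (intros; unfold chord_ratio; ring).
  assert (inj : forall z w, z <> w -> frame c u (stretch a b z) <> frame c u (stretch a b w)).
  { intros z w n e. apply n.
    destruct (frame_coord c u (stretch a b z) hu) as [p q].
    destruct (frame_coord c u (stretch a b w) hu) as [p' q'].
    rewrite e, p' in p. rewrite e, q' in q. unfold stretch in p, q; simpl in p, q.
    rewrite (surjective_pairing z), (surjective_pairing w).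
    apply Rmult_eq_reg_l in p; [|lra]. apply Rmult_eq_reg_l in q; [|lra]. congruence. }
  unfold triangular_orbit.
  rewrite !(reflection_law_iff E c u a b) by auto.
  split.
  - intros (_ & _ & _ & _ & _ & _ & l1 & l2 & _).
    pose proof (chord_ratio_pos a b z1 z2 ha hb u1 u2) as w12.
    set (J' := gap z1 z2 / chord_ratio a b z1 z2).
    assert (g12 : gap z1 z2 = J' * chord_ratio a b z1 z2) by (unfold J'; field; lra).
    assert (g31 : gap z3 z1 = J' * chord_ratio a b z3 z1).
    { rewrite (sg z3 z1), (sw z3 z1). apply (Rmult_eq_reg_r (chord_ratio a b z1 z2)); [|lra].
      rewrite l1, g12; ring. }
    assert (g23 : gap z2 z3 = J' * chord_ratio a b z2 z3).
    { apply (Rmult_eq_reg_r (chord_ratio a b z1 z2)); [|lra].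
      rewrite (sw z1 z2), <- l2, (sg z2 z1), g12, (sw z2 z1); ring. }
    assert (hJ' : 0 < J').
    { apply Rdiv_lt_0_compat; auto. pose proof (unit_dot_lt z1 z2 u1 u2 n12). unfold gap; lra. }
    apply (gap_chord_ratio_iff a b J' z1 z2 u1 u2) in g12.
    apply (gap_chord_ratio_iff a b J' z2 z3 u2 u3) in g23.
    apply (gap_chord_ratio_iff a b J' z3 z1 u3 u1) in g31.
    destruct (phases_of_conjugate _ _ z1 z2 z3 n12 n23 n31 u1 u2 u3 g12 g23 g31) as [s2 e].
    rewrite (multiplier_unique a b J J'); auto. rewrite <- e; ring.
  - intros s2.
    assert (G : forall x y z : C, dot x x = 1 -> dot y y = 1 -> dot z z = 1 ->
      (x * y + y * z + z * x = - RtoC (J * (a ^ 2 - b ^ 2)))%C ->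
      gap x y = J * chord_ratio a b x y).
    { intros x y z hx hy hz e. apply gap_chord_ratio_iff; auto.
      apply (conjugate_of_phases _ _ x y z); auto. rewrite <- hJ2; ring. }
    assert (g12 := G z1 z2 z3 u1 u2 u3 s2).
    assert (g23 : gap z2 z3 = J * chord_ratio a b z2 z3).
    { apply (G z2 z3 z1); auto. rewrite <- s2; ring. }
    assert (g31 : gap z3 z1 = J * chord_ratio a b z3 z1).
    { apply (G z3 z1 z2); auto. rewrite <- s2; ring. }
    repeat split; auto; try (apply hE; eexists; split; [|reflexivity]; auto).
    + rewrite (sg z1 z3), (sw z1 z3), g31, g12; ring.
    + rewrite (sg z2 z1), (sw z2 z1), g23, g12; ring.
    + rewrite (sg z3 z2), (sw z3 z2), g31, g23; ring.
Qed.

Theorem theorem1p1 (E : point -> Prop) (hE : is_ellipse E) (hnc : ~ is_circle E) :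
  is_ellipse (circumcenters E).
Proof.
  destruct hE as (c & u & a & b & hu & ha & hb & hE).
  assert (na : a <> 0) by lra. assert (nb : b <> 0) by lra.
  assert (hEz : forall P, E P <-> exists z, dot z z = 1 /\ P = frame c u (stretch a b z)).
  { intros P. rewrite hE. apply ellipse_param; auto. }
  assert (hab : a ^ 2 - b ^ 2 <> 0).
  { intros e. assert (a = b) by nra. subst b. apply hnc. apply (stretch_equal_circle E c u a); auto. }
  destruct (multiplier_exists a b ha hb) as [J [hJ hJ2]].
  pose proof (multiplier_bound a b J ha hb hJ hJ2) as hW.
  set (W := J * (a ^ 2 - b ^ 2)) in *.
  set (al := (a ^ 2 - b ^ 2) * (1 - W) / (4 * a)).
  set (be := (a ^ 2 - b ^ 2) * (1 + W) / (4 * b)).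
  pose proof (Rabs_def2 _ _ hW) as [hW1 hW2].
  assert (nal : al <> 0).
  { unfold al. apply Rmult_integral_contrapositive_currified; [|apply Rinv_neq_0_compat; lra].
    apply Rmult_integral_contrapositive_currified; lra. }
  assert (nbe : be <> 0).
  { unfold be. apply Rmult_integral_contrapositive_currified; [|apply Rinv_neq_0_compat; lra].
    apply Rmult_integral_contrapositive_currified; lra. }
  exists c, u, (Rabs al), (Rabs be).
  split; auto. split; [now apply Rabs_pos_lt|]. split; [now apply Rabs_pos_lt|].
  intros O. rewrite !pow2_abs. rewrite (ellipse_param c u al be hu nal nbe).
  split.
  - intros (A1 & A2 & A3 & ho & [r [hr [c1 [c2 c3]]]]).
    destruct (proj1 (hEz A1) (proj1 ho)) as [z1 [u1 ->]].
    destruct (proj1 (hEz A2) (proj1 (proj2 ho))) as [z2 [u2 ->]].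
    destruct (proj1 (hEz A3) (proj1 (proj2 (proj2 ho)))) as [z3 [u3 ->]].
    pose proof ho as (_ & _ & _ & m12 & m23 & m31 & _).
    assert (n12 : z1 <> z2) by congruence. assert (n23 : z2 <> z3) by congruence.
    assert (n31 : z3 <> z1) by congruence.
    apply (orbit_iff E c u a b J z1 z2 z3) in ho; auto.
    exists (z1 * z2 * z3)%C. split.
    + apply unit_mult; auto. apply unit_mult; auto.
    + rewrite (frame_surj c u O hu) in c1, c2, c3 |- *.
      set (X := (dot (psub O c) u, dot (psub O c) (perp u))) in *. f_equal.
      unfold circle in c1, c2, c3. rewrite dist2_frame in c1, c2, c3 by auto.
      destruct (phases_circumcenter a b W z1 z2 z3 na nb u1 u2 u3 ho) as [q2 q3].
      assert (SI : forall P Q, sqrt (dot P P) = sqrt (dot Q Q) -> dot P P = dot Q Q).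
      { intros P Q e. apply sqrt_inj; auto; unfold dot; nra. }
      apply (equidistant_unique X _ (stretch a b z1) (stretch a b z2) (stretch a b z3)); auto.
      * apply stretch_noncollinear; auto.
      * apply SI. congruence.
      * apply SI. congruence.
  - intros [zeta [hz ->]].
    destruct (phases_exist W zeta hz hW) as (z1 & z2 & z3 & u1 & u2 & u3 & s2 & s3).
    assert (n12 : z1 <> z2) by (apply (phases_distinct W z1 z2 z3); auto).
    assert (n23 : z2 <> z3).
    { apply (phases_distinct W z2 z3 z1); auto. rewrite <- s2; ring. }
    assert (n31 : z3 <> z1).
    { apply (phases_distinct W z3 z1 z2); auto. rewrite <- s2; ring. }
    exists (frame c u (stretch a b z1)), (frame c u (stretch a b z2)), (frame c u (stretch a b z3)).
    split; [apply (orbit_iff E c u a b J); auto|].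
    destruct (phases_circumcenter a b W z1 z2 z3 na nb u1 u2 u3 s2) as [q2 q3].
    rewrite s3 in q2, q3. fold al be in q2, q3.
    set (Z := stretch al be zeta) in *.
    exists (sqrt (dot (psub Z (stretch a b z1)) (psub Z (stretch a b z1)))).
    unfold circle. rewrite !dist2_frame by auto. repeat split; try congruence.
    (* The radius is positive: otherwise all three vertices sit at the center. *)
    apply sqrt_lt_R0.
    destruct (Rlt_le_dec 0 (dot (psub Z (stretch a b z1)) (psub Z (stretch a b z1)))) as [?|h]; auto.
    exfalso. apply n12.
    assert (V : forall P Q : point, dot (psub P Q) (psub P Q) <= 0 -> P = Q).
    { intros [p1 p2] [q1 q2']. unfold dot, psub; simpl. intros k.
      pose proof (Rle_0_sqr (p1 - q1)) as k1. pose proof (Rle_0_sqr (p2 - q2')) as k2.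
      unfold Rsqr in k1, k2.
      f_equal; apply Rminus_diag_uniq, Rsqr_0_uniq; unfold Rsqr; lra. }
    pose proof (V _ _ h) as e1. rewrite q2 in h. pose proof (V _ _ h) as e2. rewrite e1 in e2.
    injection e2 as f1 f2. apply Rmult_eq_reg_l in f1; auto. apply Rmult_eq_reg_l in f2; auto.
    rewrite (surjective_pairing z1), (surjective_pairing z2). congruence.
Qed.
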